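(* Let $n\ge 2$. If $S=\{x_1,\ldots,x_{2(n+1)}\}$ is a maximum obtuse almost-equiangular subset of $S^{n-1}$, then $S$ is a spherical $2$-design.
   Context: $S^{n-1}=\{x\in\mathbb{R}^n:\|x\|=1\}$ and $x\cdot y$ is the Euclidean inner product. For $t\in[-1,1)$, a set $S\subseteq S^{n-1}$ is $t$-almost-equiangular if every three distinct points $x,y,z\in S$ satisfy $t\in\{x\cdot y,\,x\cdot z,\,y\cdot z\}$. A maximum obtuse almost-equiangular subset of $S^{n-1}$ is a $(-1/n)$-almost-equiangular subset of $S^{n-1}$ with exactly $2(n+1)$ (distinct) points. A finite nonempty set $X\subseteq S^{n-1}$ is a spherical $2$-design if for every real polynomial $g$ in $n$ variables of degree at most $2$ the average $\frac1{|X|}\sum_{x\in X} g(x)$ equals the average of $g$ over $S^{n-1}$ with respect to the normalized rotation-invariant measure. *)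

(* Defs.v *)
From HB Require Import structures.
From mathcomp Require Import all_boot all_order all_algebra finmap.
From mathcomp Require Import all_classical all_reals all_analysis.
(* The notations of mpoly clash with those of all_analysis. *)
From mathcomp Require mpoly.
Import -(notations) mpoly.

Set Implicit Arguments.
Unset Strict Implicit.
Unset Printing Implicit Defensive.

Import Order.TTheory GRing.Theory Num.Theory.
Import numFieldNormedType.Exports.

Local Open Scope classical_set_scope.
Local Open Scope ring_scope.

Section EuclideanSphere.
Variables (R : realType) (n : nat).

Definition dot (x y : 'rV[R]_n) : R := \sum_(i < n) x 0 i * y 0 i.

(* The library norm on 'rV[R]_n is the sup norm, hence this one. *)
Definition enorm (x : 'rV[R]_n) : R := Num.sqrt (dot x x).

(* S^{n-1} *)
Definition sphere : set 'rV[R]_n := [set x | enorm x = 1].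

Definition almost_equiangular (t : R) (S : set 'rV[R]_n) : Prop :=
  S `<=` sphere /\
  forall x y z, S x -> S y -> S z -> x <> y -> x <> z -> y <> z ->
    [\/ t = dot x y, t = dot x z | t = dot y z].

Definition max_obtuse_almost_equiangular (S : {fset 'rV[R]_n}) : Prop :=
  almost_equiangular (- n%:R^-1) [set` S] /\ #|` S|%fset = (2 * n.+1)%N.

(* R^n with its Borel sigma-algebra. *)
Definition borel_rV := g_sigma_algebraType (@open 'rV[R]_n).

Definition rotation (Q : 'M[R]_n) : Prop := Q *m Q^T = 1%:M /\ \det Q = 1.

(* The normalized rotation-invariant measure on S^{n-1}, seen as a Borel
   probability measure on R^n concentrated on the sphere. For n >= 2 there is
   exactly one such measure. *)
Definition uniform_on_sphere (sigma : probability borel_rV R) : Prop :=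
  sigma (sphere : set borel_rV) = 1%E /\
  forall (Q : 'M[R]_n) (A : set borel_rV), rotation Q -> measurable A ->
    sigma ((fun x : 'rV[R]_n => x *m Q) @^-1` A) = sigma A.

Definition peval (g : mpoly.mpoly n R) (x : 'rV[R]_n) : R :=
  mpoly.meval (fun i => x 0 i) g.

(* msize is the total degree plus one (and 0 for the zero polynomial), so
   msize g <= k.+1 says that g has degree at most k. *)
Definition spherical_design (k : nat) (X : {fset 'rV[R]_n}) : Prop :=
  [/\ X != fset0, [set` X] `<=` sphere &
      forall sigma : probability borel_rV R, uniform_on_sphere sigma ->
      forall g : mpoly.mpoly n R, (mpoly.msize g <= k.+1)%N ->
        ((\sum_(x <- X) peval g x) / #|` X|%fset%:R)%R%:E =
        (\int[sigma]_(x in (sphere : set borel_rV)) (peval g x)%:E)%E].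

End EuclideanSphere.

(* Main.v *)
Require Import Defs.
From mathcomp Require Import all_boot all_order all_fingroup all_algebra finmap.
From mathcomp Require Import ring lra.
From mathcomp Require Import all_classical all_reals all_analysis measurable_realfun.
From mathcomp Require mpoly.
Import -(notations) mpoly.

(** Why the theorem holds. Write t = -1/n and lift each of the N = 2(n+1) points
    x of S to y = (x, 1/sqrt n) in R^(n+1). Then y . y' = x . x' - t, so the
    lifted vectors have square norm c = 1 + 1/n and among any three of them two
    are orthogonal. Let A be their Gram matrix and M = A - c I. The diagonal of M
    vanishes and so does one entry in every off-diagonal triangle, hence
    tr M = 0 and tr M^3 = 0. On the other hand A has rank at most n + 1 = N/2,
    so N/2 eigenvalues of M equal -c, and the other ones, u_1, ..., u_(N/2), are
    at least -c and satisfy sum u_i = (N/2) c and sum u_i^3 = (N/2) c^3. Since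
      u^3 - 3 c^2 u + 2 c^3 = (u - c)^2 (u + 2c) >= 0
    adds up to 0, every u_i equals c. In other words the frame operator
    B = sum y y^T, whose spectrum is that of A without N/2 zeros, is 2c I
    ([tight_frame_of_orthogonal_triples]; the proof there replaces eigenvalues
    by traces of positive semidefinite matrices).

    The block of B on the first n coordinates says that sum x x^T = (N/n) I, and
    its last column says that sum x = 0: the points of S have the first and
    second moments of the uniform measure on the sphere. The latter are computed
    from the invariance under quarter turns (a, b) -> (b, -a) of coordinate
    planes ([moment1], [moment2]), and equality of the moments of degree at most
    2 is the design property ([spherical_design2_of_moments]). *)

Set Implicit Arguments.
Unset Strict Implicit.
Unset Printing Implicit Defensive.
Import Order.TTheory GRing.Theory Num.Theory.
Import numFieldNormedType.Exports.
Local Open Scope classical_set_scope.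
Local Open Scope ring_scope.

(** * Tight frames from orthogonality patterns *)

Lemma mxtrace_mul_tr_ge0 (R : realFieldType) (m p : nat) (A : 'M[R]_(m, p)) :
  0 <= \tr (A *m A^T).
Proof.
rewrite /mxtrace sumr_ge0// => i _; rewrite mxE sumr_ge0// => j _.
by rewrite mxE -expr2 sqr_ge0.
Qed.

Lemma mxtrace_mul_tr_eq0 (R : realFieldType) (m p : nat) (A : 'M[R]_(m, p)) :
  \tr (A *m A^T) = 0 -> A = 0.
Proof.
have sq i j : 0 <= A i j * A^T j i by rewrite mxE -expr2 sqr_ge0.
move=> /eqP; rewrite /mxtrace psumr_eq0 => [/allP A0|i _]; last first.
  by rewrite mxE sumr_ge0.
apply/matrixP => i j; rewrite [RHS]mxE; have := A0 i (mem_index_enum i).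
rewrite mxE psumr_eq0//= => /allP/(_ j (mem_index_enum j)).
by rewrite /= mxE mulf_eq0 orbb => /eqP.
Qed.

(** The rows of [Y] are 2p vectors of square norm [c] in dimension p, two of which
    are orthogonal among any three. With B = Y^T Y and D = B - 2c I, vanishing of
    tr (Y Y^T - c I)^3 turns into tr (D B D) + c tr (D D) = 0, because
    b^3 - 3 c b^2 + 4 c^3 = b (b - 2c)^2 + c (b - 2c)^2. Both terms are
    nonnegative, being traces of Gram matrices, so D = 0. *)
Lemma tight_frame_of_orthogonal_triples (R : realFieldType) (m p : nat) (c : R)
    (Y : 'M[R]_(m, p)) :
  0 < c -> m = (2 * p)%N ->
  (forall i, (Y *m Y^T) i i = c) ->
  (forall i j k, i != j -> i != k -> j != k ->
     [\/ (Y *m Y^T) i j = 0, (Y *m Y^T) i k = 0 | (Y *m Y^T) j k = 0]) ->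
  Y^T *m Y = (2 * c)%:M.
Proof.
move=> c0 mE dY nY.
set A := Y *m Y^T in dY nY; set B := Y^T *m Y.
pose M := A - c%:M; pose D := B - (2 * c)%:M.
have ME i j : M i j = A i j - c *+ (i == j) by rewrite !mxE.
have AC i j : A i j = A j i.
  by rewrite !mxE; apply: eq_bigr => k _; rewrite !mxE mulrC.
(* Each term M i k * M k j * M j i of the trace contains a zero factor. *)
have M3 : \tr (M *m M *m M) = 0.
  rewrite /mxtrace big1// => i _; rewrite mxE big1// => j _.
  rewrite mxE big_distrl big1//= => k _; rewrite !ME.
  have [<-|ik] := eqVneq i k; first by rewrite dY subrr !mul0r.
  have [<-|kj] := eqVneq k j; first by rewrite dY subrr mulr0 mul0r.
  have [<-|ji] := eqVneq j i; first by rewrite dY subrr mulr0.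
  rewrite !subr0 (AC j i).
  have ij : i != j by rewrite eq_sym.
  by case: (nY i k j ik ij kj) => ->; rewrite !(mul0r, mulr0).
have trA : \tr A = c * (2 * p%:R).
  rewrite /mxtrace (eq_bigr (fun=> c))// sumr_const card_ord mE.
  by rewrite -[LHS]mulr_natr natrM.
have trB2 : \tr (B *m B) = \tr (A *m A).
  by rewrite /A /B -mulmxA mxtrace_mulC !mulmxA.
have trB3 : \tr (B *m B *m B) = \tr (A *m A *m A).
  by rewrite /A /B -!mulmxA mxtrace_mulC !mulmxA.
have EM : M *m M *m M = A *m A *m A - (3 * c) *: (A *m A)
    + (3 * c ^+ 2) *: A - (c ^+ 3)%:M.
  rewrite /M !(mulmxBl, mulmxBr) !mul_scalar_mx !mul_mx_scalar !scale_scalar_mx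
    !mul_scalar_mx.
  (* Forgetting the products keeps mxE from expanding them into sums. *)
  rewrite -!scalemxAl; move: (A *m A *m A) (A *m A) (A) => A3 A2 A1.
  by apply/matrixP => i j; rewrite !mxE; case: (i == j);
    rewrite ?mulr1n ?mulr0n; ring.
have ED : D *m B *m D + c *: (D *m D) = B *m B *m B - (3 * c) *: (B *m B)
    + (4 * c ^+ 3)%:M.
  rewrite /D !(mulmxBl, mulmxBr) !mul_scalar_mx !mul_mx_scalar
    !scale_scalar_mx ?mul_scalar_mx.
  rewrite -!scalemxAl; move: (B *m B *m B) (B *m B) (B) => B3 B2 B1.
  by apply/matrixP => i j; rewrite !mxE; case: (i == j);
    rewrite ?mulr1n ?mulr0n; ring.
have DT : D^T = D by rewrite /D linearB /= tr_scalar_mx trmx_mul trmxK.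
have D2 : \tr (D *m D) = \tr (D *m D^T) by rewrite DT.
have DBD : \tr (D *m B *m D) = \tr ((D *m Y^T) *m (D *m Y^T)^T).
  by rewrite trmx_mul trmxK DT !mulmxA.
have : \tr (D *m B *m D) + c * \tr (D *m D) = 0.
  rewrite -mxtraceZ -mxtraceD ED.
  move: M3; rewrite EM !(raddfD, raddfN) /= !mxtraceZ !mxtrace_scalar.
  have -> : c ^+ 3 *+ m = c ^+ 3 * (2 * p%:R) by rewrite mE -[LHS]mulr_natr natrM.
  by rewrite trB2 trB3 trA => M3; rewrite -M3; ring.
rewrite DBD D2 => /eqP; rewrite paddr_eq0 ?mulr_ge0 ?mxtrace_mul_tr_ge0 ?ltW//.
case/andP => _; rewrite mulf_eq0 gt_eqF//= => /eqP/mxtrace_mul_tr_eq0.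
exact: subr0_eq.
Qed.

(** * The sphere and its quarter turns *)

Section Sphere.
Variables (R : realType) (n : nat).
Implicit Types x : 'rV[R]_n.

Lemma dot_ge0 x : 0 <= dot x x.
Proof. by rewrite sumr_ge0// => i _; rewrite -expr2 sqr_ge0. Qed.

Lemma sphereP x : sphere x <-> dot x x = 1.
Proof.
rewrite /sphere/= /enorm; split=> [x1|->]; last by rewrite sqrtr1.
by rewrite -[LHS]sqr_sqrtr ?dot_ge0// x1 expr1n.
Qed.

Lemma coord_sphere_le1 x i : sphere x -> `|x 0 i| <= 1.
Proof.
move=> /sphereP; rewrite /dot (bigD1 i)//= => x1.
rewrite -(@expr_le1 _ 2)// real_normK ?num_real// -x1 -expr2 lerDl.
by rewrite sumr_ge0// => j _; rewrite -expr2 sqr_ge0.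
Qed.

Lemma dot_mulmx_orthogonal (Q : 'M[R]_n) x : Q *m Q^T = 1%:M ->
  dot (x *m Q) (x *m Q) = dot x x.
Proof.
have dotE z : dot z z = (z *m z^T) 0 0.
  by rewrite mxE; apply: eq_bigr => i _; rewrite mxE.
by move=> QQ; rewrite !dotE trmx_mul mulmxA -(mulmxA x) QQ mulmx1.
Qed.

(** The rotation by a right angle in the plane of the coordinates [i] and [j].
    It is available in every dimension at least 2 and alone determines the
    moments up to degree 2; sign changes of two coordinates would not do so when
    n = 2. *)
Definition quarter_turn (i j : 'I_n) : 'M[R]_n :=
  diag_mx (\row_k (-1) ^+ (k == i)) *m perm_mx (tperm i j).

Lemma quarter_turnE i j x k :
  (x *m quarter_turn i j) 0 k =
  (-1) ^+ (tperm i j k == i) * x 0 (tperm i j k).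
Proof.
rewrite /quarter_turn mulmxA -[tperm i j in LHS]invgK -tpermV -col_permE mxE.
by rewrite mul_mx_diag !mxE invgK tpermV mulrC.
Qed.

Lemma rotation_quarter_turn i j : i != j -> rotation (quarter_turn i j).
Proof.
move=> ij; split.
  rewrite /quarter_turn trmx_mul tr_perm_mx tr_diag_mx mulmxA -(mulmxA (diag_mx _)).
  rewrite -perm_mxM mulgV perm_mx1 mulmx1 mulmx_diag.
  by apply/matrixP => k l; rewrite !mxE -expr2 sqrr_sign.
rewrite det_mulmx det_diag det_perm odd_tperm ij (bigD1 i)//= big1.
  by rewrite mxE eqxx mulr1 mulrNN mulr1.
by move=> k ki; rewrite mxE (negbTE ki).
Qed.

End Sphere.

(** * Measurability *)

Section BorelRowVectors.
Variables (R : realType) (n : nat).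

Lemma measurable_coord (i : 'I_n) :
  measurable_fun [set: borel_rV R n] (fun x : borel_rV R n => (x : 'rV[R]_n) 0 i).
Proof.
apply: (measurability _ (RGenOpens.measurableE R)) => _ [_ [a [b ->] <-]].
rewrite setTI; apply: sub_sigma_algebra.
apply: open_comp; last exact: interval_open.
by move=> x _; exact: coord_continuous.
Qed.

Lemma measurable_continuous_rV (f : 'rV[R]_n -> 'rV[R]_n) :
  continuous f ->
  measurable_fun [set: borel_rV R n] (f : borel_rV R n -> borel_rV R n).
Proof.
move=> cf; apply: (@measurability _ _ (borel_rV R n) (borel_rV R n) setT f
  (@open 'rV[R]_n)) => // _ [A oA <-].
by rewrite setTI; apply: sub_sigma_algebra; apply: open_comp.
Qed.

Lemma continuous_mulmx (Q : 'M[R]_n) : continuous (fun x : 'rV[R]_n => x *m Q).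
Proof.
move=> x A [P xP PA].
have xQ i j : continuous (fun y : 'rV[R]_n => (y *m Q) i j).
  under eq_fun do rewrite mxE.
  apply: continuous_big => [|k _ y]; first exact: add_continuous.
  exact: (cvgM (@coord_continuous _ _ _ i k y) (cvg_cst _)).
have Fx : Filter (nbhs x) by exact: (@nbhs_filter (matrix R 1 n : topologicalType) x).
have : \forall y \near x, forall i j, P i j ((y *m Q) i j).
  apply: (@filter_forall _ _ _ (nbhs x) Fx) => i.
  by apply: (@filter_forall _ _ _ (nbhs x) Fx) => j; exact/xQ/xP.
by apply: filterS => y; exact: PA.
Qed.

Lemma measurable_sphere : measurable (@sphere R n : set (borel_rV R n)).
Proof.
have -> : @sphere R n = (fun x : borel_rV R n => dot x x) @^-1` [set 1].
  by apply/seteqP; split=> x /sphereP.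
rewrite -[X in measurable X]setTI.
have: measurable_fun [set: borel_rV R n] (fun x : borel_rV R n => dot x x).
  apply: measurable_sum => i; apply: measurable_funM; exact: measurable_coord.
by apply.
Qed.

Lemma measurable_mulmx (Q : 'M[R]_n) : measurable_fun [set: borel_rV R n]
  ((fun x : 'rV[R]_n => x *m Q) : borel_rV R n -> borel_rV R n).
Proof. by apply: measurable_continuous_rV; exact: continuous_mulmx. Qed.

End BorelRowVectors.

(** * Moments of the uniform measure *)

Lemma Rintegral_sum (R : realType) d (T : measurableType d)
  (mu : {measure set T -> \bar R}) (D : set T) (I : eqType) (s : seq I)
  (f : I -> T -> R) :
  measurable D -> (forall i, i \in s -> mu.-integrable D (EFin \o f i)) ->
  mu.-integrable D (EFin \o (fun x => \sum_(i <- s) f i x)) /\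
  (\int[mu]_(x in D) \sum_(i <- s) f i x =
   \sum_(i <- s) \int[mu]_(x in D) f i x).
Proof.
move=> mD; elim: s => [|i s IH] fI.
  under eq_fun do rewrite big_nil.
  rewrite big_nil; split; first exact: integrable0.
  by rewrite Rintegral_cst// mul0r.
have [|Is Es] := IH; first by move=> j js; apply: fI; rewrite inE js orbT.
have Ii := fI i (mem_head _ _).
under eq_fun do rewrite big_cons.
rewrite big_cons; split; last by rewrite RintegralD// Es.
rewrite (_ : _ \o _ =
  (EFin \o f i) \+ (EFin \o (fun x => \sum_(j <- s) f j x)%R))%E//.
exact: integrableD.
Qed.

Section Moments.
Variables (R : realType) (n : nat) (sigma : probability (borel_rV R n) R).
Hypothesis sU : uniform_on_sphere sigma.

Local Notation "''E' f" := (\int[sigma]_(x in (@sphere R n : set (borel_rV R n))) f x)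
  (at level 10, f at level 9).

Lemma integrable_sphere (f : borel_rV R n -> R) :
  measurable_fun [set: borel_rV R n] f -> (forall x, sphere x -> `|f x| <= 1) ->
  sigma.-integrable (@sphere R n : set (borel_rV R n)) (EFin \o f).
Proof.
move=> mf f1; apply: measurable_bounded_integrable.
- exact: measurable_sphere.
- by apply: le_lt_trans (ltry 1); apply: probability_le1; exact: measurable_sphere.
- exact: measurable_funTS.
- exists 1; split; first exact: num_real.
  by move=> M M1 x Sx /=; apply: le_trans (ltW M1); exact: f1.
Qed.

Lemma Rintegral_rotation (Q : 'M[R]_n) (f : borel_rV R n -> R) : rotation Q ->
  measurable_fun [set: borel_rV R n] f -> (forall x, sphere x -> `|f x| <= 1) ->
  'E (fun x => f ((x : 'rV[R]_n) *m Q)) = 'E f.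
Proof.
move=> rQ mf f1.
pose phi := (fun x : 'rV[R]_n => x *m Q) : borel_rV R n -> borel_rV R n.
have mphi : measurable_fun setT phi by exact: measurable_mulmx.
have phiS : phi @^-1` (@sphere R n) = @sphere R n.
  apply/funext => x; rewrite -[LHS]/(sphere (x *m Q)) !(propext (sphereP _)).
  by rewrite dot_mulmx_orthogonal// rQ.1.
rewrite /Rintegral; congr fine; apply/esym.
rewrite -[RHS]/(\int[sigma]_(x in (@sphere R n : set (borel_rV R n)))
  ((EFin \o f) \o phi) x)%E.
rewrite -[X in (\int[sigma]_(x in X) _ x)%E]phiS.
rewrite -integral_pushforward//.
- apply: eq_measure_integral => A mA _; exact/esym/(sU.2 Q A rQ mA).
- exact/measurable_EFinP.
- rewrite phiS; apply: (@integrable_sphere (f \o phi)); first exact: measurableT_comp.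
  by move=> x Sx; apply: f1; rewrite -phiS in Sx.
- exact: measurable_sphere.
Qed.

Lemma measurable_coordM (i j : 'I_n) : measurable_fun [set: borel_rV R n]
  (fun x : borel_rV R n => (x : 'rV[R]_n) 0 i * (x : 'rV[R]_n) 0 j).
Proof. by apply: measurable_funM; exact: measurable_coord. Qed.

Lemma coordM_sphere_le1 (i j : 'I_n) (x : 'rV[R]_n) : sphere x ->
  `|x 0 i * x 0 j| <= 1.
Proof.
by move=> Sx; rewrite normrM mulr_ile1// coord_sphere_le1.
Qed.

Lemma quarter_turn_fst (i j : 'I_n) (x : 'rV[R]_n) : i != j ->
  (x *m quarter_turn R i j) 0 i = x 0 j.
Proof. by move=> ij; rewrite quarter_turnE tpermL eq_sym (negbTE ij) mul1r. Qed.

Lemma quarter_turn_snd (i j : 'I_n) (x : 'rV[R]_n) :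
  (x *m quarter_turn R i j) 0 j = - x 0 i.
Proof. by rewrite quarter_turnE tpermR eqxx mulN1r. Qed.

Lemma RintegralN_sphere (f : borel_rV R n -> R) :
  measurable_fun [set: borel_rV R n] f -> (forall x, sphere x -> `|f x| <= 1) ->
  'E (fun x => - f x) = - 'E f.
Proof.
move=> mf f1; under eq_Rintegral do rewrite -mulN1r.
rewrite RintegralZl ?mulN1r//; first exact: measurable_sphere.
exact: integrable_sphere.
Qed.

Lemma moment0 : 'E (cst 1) = 1.
Proof.
rewrite Rintegral_cst ?mul1r; last exact: measurable_sphere.
by rewrite [X in fine X](_ : _ = 1%E)//; exact: sU.1.
Qed.

(** If the quarter turn sends x_i to x_j and x_j to - x_i, then
    E x_i = E x_j = - E x_i. *)
Lemma moment1 (hn : (2 <= n)%N) (i : 'I_n) : 'E (fun x => (x : 'rV[R]_n) 0 i) = 0.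
Proof.
have [j ij] : exists j : 'I_n, i != j.
  have /card_gt1P[a [b [_ _ ab]]] : (1 < #|'I_n|)%N by rewrite card_ord.
  by have [ia|] := eqVneq i a; [exists b; rewrite ia|exists a].
have rQ := rotation_quarter_turn R ij.
have coord1 k (x : 'rV[R]_n) : sphere x -> `|x 0 k| <= 1 by exact: coord_sphere_le1.
have /= := Rintegral_rotation rQ (measurable_coord i) (coord1 i).
under eq_Rintegral do rewrite quarter_turn_fst//.
have /= := Rintegral_rotation rQ (measurable_coord j) (coord1 j).
under eq_Rintegral do rewrite quarter_turn_snd.
rewrite RintegralN_sphere; [|exact: measurable_coord|exact: coord1].
by lra.
Qed.

(** The quarter turn sends x_i x_j to its opposite. *)
Lemma moment2_neq (i j : 'I_n) : i != j ->
  'E (fun x => (x : 'rV[R]_n) 0 i * (x : 'rV[R]_n) 0 j) = 0.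
Proof.
move=> ij.
have /= := Rintegral_rotation (rotation_quarter_turn R ij) (measurable_coordM i j)
  (coordM_sphere_le1 i j).
under eq_Rintegral do rewrite quarter_turn_fst// quarter_turn_snd mulrN mulrC.
rewrite RintegralN_sphere; [|exact: measurable_coordM|exact: coordM_sphere_le1].
by lra.
Qed.

Lemma moment2_same (i j : 'I_n) :
  'E (fun x => (x : 'rV[R]_n) 0 i * (x : 'rV[R]_n) 0 i) =
  'E (fun x => (x : 'rV[R]_n) 0 j * (x : 'rV[R]_n) 0 j).
Proof.
have [->//|ij] := eqVneq i j.
have /= <- := Rintegral_rotation (rotation_quarter_turn R ij) (measurable_coordM j j)
  (coordM_sphere_le1 j j).
by apply: eq_Rintegral => x _; rewrite quarter_turn_snd mulrNN.
Qed.

(** The square moments agree, and add up to 1 because |x| = 1. *)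
Lemma moment2 (i j : 'I_n) :
  'E (fun x => (x : 'rV[R]_n) 0 i * (x : 'rV[R]_n) 0 j) = (i == j)%:R / n%:R.
Proof.
have [<-|ij] := eqVneq i j; last by rewrite moment2_neq// mul0r.
have n0 : n%:R != 0 :> R by rewrite pnatr_eq0 -lt0n (leq_ltn_trans _ (ltn_ord i)).
apply: (mulIf n0); rewrite divfK//.
have -> : 'E (fun x => (x : 'rV[R]_n) 0 i * (x : 'rV[R]_n) 0 i) * n%:R =
    \sum_(k < n) 'E (fun x => (x : 'rV[R]_n) 0 k * (x : 'rV[R]_n) 0 k).
  rewrite (eq_bigr _ (fun k _ => moment2_same k i)) sumr_const card_ord.
  by rewrite mulr_natr.
rewrite -(Rintegral_sum (@measurable_sphere R n) _).2 => [|k _]; last first.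
  by apply: integrable_sphere; [exact: measurable_coordM|exact: coordM_sphere_le1].
rewrite -[RHS]moment0; apply: eq_Rintegral => x; rewrite inE => /sphereP.
by [].
Qed.

End Moments.

(** * Designs of strength two *)

Lemma monomial_deg2 (R : comNzRingType) (n : nat) (m : mpoly.multinom n) :
  (mpoly.mdeg m <= 2)%N ->
  [\/ forall v : 'I_n -> R, \prod_i v i ^+ m i = 1,
      exists i, forall v : 'I_n -> R, \prod_i v i ^+ m i = v i |
      exists i j, forall v : 'I_n -> R, \prod_i v i ^+ m i = v i * v j].
Proof.
have prodU (m' : mpoly.multinom n) (v : 'I_n -> R) i : (0 < m' i)%N ->
    \prod_k v k ^+ m' k = v i * \prod_k v k ^+ mnm_sub m' (mnm1 i) k.
  move=> mi; rewrite (bigD1 i)//= [in RHS](bigD1 i)//= mulrA; congr (_ * _).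
    by rewrite mnmBE mnm1E eqxx -exprS subn1 prednK.
  by apply: eq_bigr => k ki; rewrite mnmBE mnm1E eq_sym (negbTE ki) subn0.
have mdegU (m' : mpoly.multinom n) i : (0 < m' i)%N ->
    mdeg (mnm_sub m' (mnm1 i)) = (mdeg m').-1.
  move=> mi; rewrite -[in RHS](@submK n (mnm1 i) m') ?mdegD ?mdeg1 ?addn1//.
  by apply/mnm_lepP => k; rewrite mnm1E; case: eqP => [<-|].
have pos (m' : mpoly.multinom n) : mdeg m' != 0%N -> exists i, (0 < m' i)%N.
  rewrite mdegE sum_nat_eq0 negb_forall => /existsP[i] /=; rewrite -lt0n.
  by exists i.
have prod0 (m' : mpoly.multinom n) (v : 'I_n -> R) : mdeg m' = 0%N ->
    \prod_k v k ^+ m' k = 1.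
  by move/eqP; rewrite mdeg_eq0 => /eqP->; apply: big1 => k _; rewrite mnm0E.
have [m0 _|/pos[i mi] m2] := eqVneq (mdeg m) 0%N.
  by apply: Or31 => v; exact: prod0.
have [m0|/pos[j mj]] := eqVneq (mdeg (mnm_sub m (mnm1 i))) 0%N.
  by apply: Or32; exists i => v; rewrite (prodU _ _ _ mi) prod0 ?mulr1.
apply: Or33; exists i, j => v; rewrite (prodU _ _ _ mi) (prodU _ _ _ mj) prod0 ?mulr1//.
by rewrite (mdegU _ _ mj) (mdegU _ _ mi); move: m2; case: (mdeg m) => [|[|[]]].
Qed.

Section Design.
Variables (R : realType) (n : nat).

(** Both averages are linear, so it suffices to compare them on the monomials of
    degree at most 2, where the hypotheses are the values of [moment1] and
    [moment2]. *)
Lemma spherical_design2_of_moments (hn : (2 <= n)%N) (X : {fset 'rV[R]_n}) :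
  X != fset0 -> [set` X] `<=` @sphere R n ->
  (forall i, \sum_(x <- X) x 0 i = 0) ->
  (forall i j, \sum_(x <- X) x 0 i * x 0 j = #|` X|%fset%:R * ((i == j)%:R / n%:R)) ->
  spherical_design 2 X.
Proof.
move=> X0 XS X1 X2; split=> // sigma sU g g2.
have N0 : #|` X|%fset%:R != 0 :> R by rewrite pnatr_eq0 cardfs_eq0.
pose mono (m : mpoly.multinom n) (x : borel_rV R n) : R :=
  \prod_i (x : 'rV[R]_n) 0 i ^+ m i.
have gE : peval g = (fun x => \sum_(m <- msupp g) mcoeff m g * mono m x).
  by apply/funext => x; rewrite /peval mevalE.
have monoP m : m \in msupp g ->
    sigma.-integrable (@sphere R n : set (borel_rV R n)) (EFin \o mono m) /\
    \sum_(x <- X) mono m x =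
      #|` X|%fset%:R * \int[sigma]_(x in (@sphere R n : set (borel_rV R n))) mono m x.
  move=> /msize_mdeg_lt mg; have := leq_trans mg g2; rewrite ltnS.
  move=> /(@monomial_deg2 R)[m1|[i m1]|[i [j m1]]].
  - have -> : mono m = cst 1 by apply/funext => x; exact: m1.
    rewrite (moment0 sU) mulr1 big_const_seq count_predT iter_addr_0; split=> //.
    apply: integrable_sphere; first exact: measurable_cst.
    by move=> x _; rewrite normr1.
  - have -> : mono m = (fun x => (x : 'rV[R]_n) 0 i) by apply/funext => x; exact: m1.
    rewrite (moment1 sU hn) mulr0; split=> //.
    apply: integrable_sphere => [|x]; first exact: measurable_coord.
    exact: coord_sphere_le1.
  - have -> : mono m = (fun x => (x : 'rV[R]_n) 0 i * (x : 'rV[R]_n) 0 j).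
      by apply/funext => x; exact: m1.
    rewrite (moment2 sU); split=> //.
    apply: integrable_sphere => [|x]; first exact: measurable_coordM.
    exact: coordM_sphere_le1.
have mS := @measurable_sphere R n.
have cI m : m \in msupp g -> sigma.-integrable (@sphere R n : set (borel_rV R n))
    (EFin \o (fun x => mcoeff m g * mono m x)).
  by move=> mg; apply: (integrableZl mS (mcoeff m g) (monoP m mg).1).
have [gI gS] := Rintegral_sum mS cI.
rewrite -gE in gI gS.
rewrite -[RHS]fineK; last exact: integrable_fin_num.
congr EFin; rewrite -[RHS]/(Rintegral _ _ _) gS gE exchange_big/= mulr_suml.
rewrite big_seq [RHS]big_seq; apply: eq_bigr => m mg.
rewrite -mulr_sumr (monoP m mg).2 RintegralZl//; last exact: (monoP m mg).1.
by rewrite -mulrA mulrAC divff// mul1r.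
Qed.

End Design.

Theorem theorem1p2 (R : realType) (n : nat) (hn : (2 <= n)%N)
    (S : {fset 'rV[R]_n}) (hS : max_obtuse_almost_equiangular S) :
  spherical_design 2 S.
Proof.
have [[SS S3] SN] := hS.
have n0 : 0 < n%:R :> R by rewrite ltr0n ltnW.
set c : R := 1 + n%:R^-1.
pose s := Num.sqrt (n%:R^-1 : R).
have ss : s * s = n%:R^-1 by rewrite -expr2 sqr_sqrtr// invr_ge0 ltW.
pose N := size (enum_fset S).
have NE : N = (2 * (n + 1))%N by rewrite addn1 -SN.
pose x (i : 'I_N) := (enum_fset S)`_i.
have xS i : x i \in S by exact: mem_nth.
have x_inj i j : i != j -> x i <> x j.
  by move=> ij /eqP; rewrite nth_uniq ?fset_uniq//; exact/negP.
have sumS (f : 'rV[R]_n -> R) : \sum_(y <- S) f y = \sum_i f (x i).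
  by rewrite (big_nth 0) big_mkord.
(* The last coordinate of the lift shifts all inner products by 1/n. *)
pose Y : 'M[R]_(N, n + 1) := \matrix_i row_mx (x i) (const_mx s).
have Yl i k : Y i (lshift 1 k) = x i 0 k by rewrite mxE row_mxEl.
have Yr i k : Y i (rshift n k) = s by rewrite mxE row_mxEr mxE.
have YtE k i : Y^T k i = Y i k by rewrite [LHS]mxE.
have YYE i j : (Y *m Y^T) i j = dot (x i) (x j) + n%:R^-1.
  rewrite mxE big_split_ord/= big_ord1 YtE !Yr ss.
  by congr (_ + _); apply: eq_bigr => k _; rewrite YtE !Yl.
have YY : Y^T *m Y = (2 * c)%:M.
  apply: tight_frame_of_orthogonal_triples => //.
  - by rewrite addr_gt0 ?invr_gt0.
  - by move=> i; rewrite YYE (sphereP _).1//; apply: SS; exact: xS.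
  - move=> i j k ij ik jk; rewrite !YYE.
    have := S3 _ _ _ (xS i) (xS j) (xS k)
      (x_inj _ _ ij) (x_inj _ _ ik) (x_inj _ _ jk).
    by case=> <-; rewrite addNr; [apply: Or31|apply: Or32|apply: Or33].
have s0 : s != 0 by rewrite gt_eqF// sqrtr_gt0 invr_gt0.
apply: spherical_design2_of_moments => //.
- by rewrite -cardfs_gt0 SN muln_gt0.
- move=> i; rewrite sumS; apply: (mulIf s0); rewrite mul0r mulr_suml.
  have := congr1 (fun A : 'M[R]_(n + 1) => A (lshift 1 i) (rshift n 0)) YY.
  rewrite mxE [RHS]mxE eq_lrshift mulr0n => YY0; rewrite -[RHS]YY0.
  by apply: eq_bigr => k _; rewrite YtE Yl Yr.
- move=> i j; rewrite sumS.
  have := congr1 (fun A : 'M[R]_(n + 1) => A (lshift 1 i) (lshift 1 j)) YY.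
  rewrite mxE [RHS]mxE eq_lshift => YYij.
  transitivity (2 * c *+ (i == j)).
    by rewrite -YYij; apply: eq_bigr => k _; rewrite YtE !Yl.
  rewrite SN natrM -natr1 -mulr_natr /c; field.
  exact: lt0r_neq0.
Qed.
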